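(* Let $a<b$ be real numbers and let $p\ge q>0$. For every Lebesgue integrable function $f:[a,b]\to[0,\infty)$, $$\int_a^b\left(\frac{1}{x-a}\int_a^x f(y)\,dy\right)^{-p}dx\le\left(\frac{p+1}{p}\right)^q\int_a^b\left(\frac{1}{x-a}\int_a^x f(y)\,dy\right)^{-p+q}f(x)^{-q}\,dx .$$ Moreover the inequality is sharp: for every real number $C<\left(\frac{p+1}{p}\right)^q$ there exists a Lebesgue integrable $f:[a,b]\to[0,\infty)$ such that the integral on the right-hand side is finite and $$\int_a^b\left(\frac{1}{x-a}\int_a^x f(y)\,dy\right)^{-p}dx> C\int_a^b\left(\frac{1}{x-a}\int_a^x f(y)\,dy\right)^{-p+q}f(x)^{-q}\,dx .$$
   Context: Integrals of nonnegative measurable functions take values in $[0,+\infty]$, and the inequality is understood in $[0,+\infty]$. Conventions: $0^{-r}=+\infty$ for $r>0$, $0^0=1$, and $(+\infty)\cdot c=+\infty$ for $c\in(0,+\infty]$. *)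

(* Defs.v *)
From HB Require Import structures.
From mathcomp Require Import all_boot all_order all_algebra.
From mathcomp Require Import all_classical all_reals all_analysis.

Set Implicit Arguments.
Unset Strict Implicit.
Unset Printing Implicit Defensive.

Import Order.TTheory GRing.Theory Num.Theory.
Import numFieldNormedType.Exports.

Local Open Scope classical_set_scope.
Local Open Scope ring_scope.

(* The library's [powR] sets 0 `^ r = 0 for r <> 0; here 0 to a negative power
   is +oo, while 0 to the power 0 is still 1.  Only used for 0 <= x. *)
Definition powe {R : realType} (x r : R) : \bar R :=
  if (x == 0) && (r < 0) then +oo%E else (x `^ r)%:E.

(* The integral is taken on the completion of the Borel sigma-algebra, so that
   [f] may be any Lebesgue-measurable function.  The value at x = a is
   0^-1 * 0 = 0, which only matters on a null set. *)
Definition avg {R : realType} (a : R) (f : R -> R) (x : R) : R :=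
  (x - a)^-1 * (\int[@completed_lebesgue_measure R]_(y in `[a, x]) f y)%R.

(* Main.v *)
Require Import Defs.
From HB Require Import structures.
From mathcomp Require Import all_boot all_order all_algebra.
From mathcomp Require Import all_classical all_reals all_analysis.
From mathcomp Require Import measurable_realfun ring lra.
Import Order.TTheory GRing.Theory Num.Theory.
Import numFieldNormedType.Exports.

(** Write [s = x - a], [F] for the primitive of [f] vanishing at [a],
    [A = F / s] and [K = (p + 1) / p].  The inequality combines two consequences
    of the tangent line inequality [1 + r <= r * w + w `^ (- r)]
    ([powR_tangent]).

    Young's inequality ([young_powR]) at [w = f / (K A)], with equality when
    [f = K A], gives pointwise
      [(1 + q) A^(-p) <= (q / K) A^(-p-1) f + K^q A^(-p+q) f^(-q)].
    Next, [s^(p+1) F^(-p) = s A^(-p)] has derivative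
    [(p + 1) A^(-p) - p A^(-p-1) f]; as it is nonnegative at [b], integration
    gives [\int A^(-p-1) f <= K \int A^(-p)] as soon as it vanishes at [a]
    ([energy_le]).  Integrating Young's inequality and inserting this bound, the
    term [q \int A^(-p)] is absorbed by the left-hand side, if that integral is
    finite, and the theorem remains.

    Finiteness and the vanishing at [a] are free when [f >= eps > 0], since then
    [A >= eps] ([hardy_bounded_below]).  The general case follows by applying
    this to [f + eps]: its average is [A + eps], the right-hand side only gets
    smaller because [- p + q] and [- q] are nonpositive (this is where [q <= p]
    enters), and the left-hand sides increase to [\int A^(-p)] as [eps]
    decreases to [0] ([hardy_inequality]).

    As [f] is only integrable, [F] need not be differentiable, and the
    integration above is done by convexity: the function [s^(p+1) F^(-p)] is
    jointly convex in [(s, F)], so its increment over an interval is at most the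
    slope at the right endpoint applied to the increment of [(s, F)]
    ([perspective_convex]).  Since [A] is continuous, freezing it at the right
    endpoint of a short interval costs at most [eta] times the integral of a
    fixed function; these local comparisons are glued by
    [locally_nondecreasing_le].

    For sharpness take [f = s^al] with [0 < al < 1 / p]: then
    [A = f / (al + 1)], which turns both integrands into multiples of the
    integrable function [s^(- al p)], and the ratio of the two sides is
    [(al + 1)^q].  It tends to [K^q] as [al] tends to [1 / p] ([hardy_sharp]). *)

Set Implicit Arguments.
Unset Strict Implicit.
Unset Printing Implicit Defensive.

Local Open Scope classical_set_scope.
Local Open Scope ring_scope.

(** * The completed Lebesgue measure *)

(** The real line carrying the sigma-algebra of Lebesgue-measurable sets, which
    is the domain of the completed measure; [R] itself is equipped with the
    Borel sets. *)
Definition lebT (R : realType) : Type :=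
  caratheodory_type ((wlength (R := R) idfun)^*)%mu.
HB.instance Definition _ (R : realType) := Measurable.on (lebT R).

Local Notation nu := (@completed_lebesgue_measure _).

Lemma borel_lebT (R : realType) (A : set R) :
  measurable A -> measurable (A : set (lebT R)).
Proof. by move=> mA; apply: sub_caratheodory. Qed.

Lemma measurable_itv_lebT (R : realType) (i : interval R) :
  measurable ([set` i] : set (lebT R)).
Proof. exact: borel_lebT. Qed.

#[local] Hint Extern 0 (@measurable _ _ _) =>
  solve [apply: measurable_itv_lebT] : core.

Lemma measurable_fun_lebT (R : realType) d (U : measurableType d) (D : set R)
    (f : R -> U) : measurable D ->
  measurable_fun D f -> measurable_fun (D : set (lebT R)) f.
Proof. by move=> mD mf _ B mB; apply: borel_lebT; exact: mf. Qed.

(** The identity from the Lebesgue-measurable to the Borel structure pushes the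
    completed measure forward to the Lebesgue measure.  This gives access to the
    fundamental theorem of calculus, which is stated for the latter. *)
Lemma integral_nu (R : realType) (D : set R) (f : R -> \bar R) :
  measurable D -> measurable_fun D f -> (forall x, D x -> (0 <= f x)%E) ->
  (\int[nu]_(x in D) f x = \int[lebesgue_measure]_(x in D) f x)%E.
Proof.
move=> mD mf f0.
have mid : measurable_fun (setT : set (lebT R)) (fun x => x : measurableTypeR R).
  by move=> _ B mB; apply: borel_lebT; rewrite setTI.
have := @ge0_integral_pushforward _ _ _ (measurableTypeR R) R _ mid nu D f mD mf.
move=> <-; last by move=> x; rewrite inE; exact: f0.
by apply: eq_measure_integral.
Qed.

(** The left endpoint [a] has to be removed because the average there is [0] by
    convention, whatever the function. *)
Lemma integral_nu_obnd_cbnd (R : realType) (a b : R) (u : R -> \bar R) :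
  a <= b ->
  measurable_fun (`]a, b] : set (lebT R)) u ->
  (forall x, a <= x <= b -> (0 <= u x)%E) ->
  (\int[nu]_(x in `[a, b]) u x = \int[nu]_(x in `]a, b]) u x)%E.
Proof.
move=> ab mu u0.
have ma : measurable ([set a] : set (lebT R)) by exact: borel_lebT.
have E : [set a] `|` `]a, b]%classic = `[a, b]%classic by rewrite setU1itv.
rewrite -E (@ge0_integral_setU _ (lebT R) R nu)//.
- have -> : (\int[nu]_(x in [set a]) u x = 0)%E.
    apply: (@null_set_integral _ (lebT R) R nu) => //.
      exact: (@measurable_fun_set1 _ _ (lebT R)).
    exact: (@lebesgue_measure_set1 R a).
  by rewrite add0e.
- apply/measurable_funU => //; split => //.
  exact: (@measurable_fun_set1 _ _ (lebT R)).
- by rewrite E => x; rewrite /= in_itv/= => /u0.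
- by apply/disj_setPS => x [/= ->]; rewrite in_itv/= ltxx.
Qed.

Lemma nu_itv_lty (R : realType) (s : bool) (u v : R) :
  (nu [set` Interval (BSide s u) (BRight v)] < +oo)%E.
Proof.
rewrite [X in (X < _)%E](_ : _ =
  lebesgue_measure [set` Interval (BSide s u) (BRight v)])//.
by rewrite lebesgue_measure_itv/=; case: ifPn => _; rewrite ?ltry// -EFinD ltry.
Qed.

Lemma Rintegral_nu_cst (R : realType) (s : bool) (k u v : R) : u <= v ->
  \int[nu]_(t in [set` Interval (BSide s u) (BRight v)]) k = k * (v - u).
Proof.
move=> uv; rewrite Rintegral_cst//; congr (_ * _).
transitivity (fine (lebesgue_measure [set` Interval (BSide s u) (BRight v)])) => //.
rewrite lebesgue_measure_itv/= lte_fin; case: ifPn => [_|].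
  by rewrite -EFinD.
by rewrite -leNgt => vu; apply/esym/eqP; rewrite subr_eq0 eq_le vu uv.
Qed.

Lemma bounded_integrable_nu (R : realType) (u v M : R) (k : R -> R) :
  measurable_fun (`]u, v]%classic : set (lebT R)) k ->
  (forall x, u < x <= v -> `|k x| <= M) ->
  nu.-integrable `]u, v] (EFin \o k).
Proof.
move=> mk kM; apply: measurable_bounded_integrable => //.
  exact: nu_itv_lty.
exists M; split; first exact: num_real.
move=> N MN x; rewrite /= in_itv/= => xuv.
by rewrite (le_trans (kM _ xuv))// ltW.
Qed.

Lemma integrable_cst_nu (R : realType) (s : bool) (u v k : R) :
  nu.-integrable
    [set` Interval (BSide s u) (BRight v)] (fun=> k%:E).
Proof.
apply: (@measurable_bounded_integrable _ (lebT R) R nu (fun=> k)) => //.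
- exact: nu_itv_lty.
- by exists `|k|; split => // N kN y _ /=; exact: ltW.
Qed.

Lemma Rintegral_nu_itv_split (R : realType) (l : itv_bound R) (u v : R)
    (k : R -> R) :
  nu.-integrable [set` Interval l (BRight v)] (EFin \o k) ->
  (l <= BRight u)%O -> u <= v ->
  \int[nu]_(y in [set` Interval l (BRight v)]) k y =
  \int[nu]_(y in [set` Interval l (BRight u)]) k y +
  \int[nu]_(y in `]u, v]) k y.
Proof.
move=> ki lu uv.
have E := @itv_bndbnd_setU _ R l (BRight u) (BRight v) lu uv.
have mi (i : interval R) : measurable ([set` i] : set (lebT R)).
  by apply: borel_lebT.
rewrite E Rintegral_setU//.
- by rewrite -E.
- apply/disj_setPS => y /=.
  by case: l {ki lu E} => [[] l|[]]; rewrite !in_itv//= => -[]; lra.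
Qed.

(** * Powers *)

(** The convex function [w `^ (- r)] lies above its tangent at [w = 1]. *)
Lemma powR_tangent (R : realType) (r w : R) : 0 < r -> 0 < w ->
  1 + r <= r * w + w `^ (- r).
Proof.
move=> r0 w0.
have -> : w `^ (- r) = expR (- r * ln w) by rewrite /powR gt_eqF.
have h1 := expR_ge1Dx (- r * ln w).
have h2 : ln w <= w - 1.
  by rewrite -[in leLHS](subrKC 1 w) le_ln1Dx// ltrBrDl subrr.
have h3 : r * ln w <= r * (w - 1) by rewrite ler_wpM2l// ltW.
rewrite mulNr in h1; rewrite mulrBr mulr1 in h3.
rewrite mulNr; lra.
Qed.

Lemma ler_powR_npos (R : realType) (r x y : R) : r <= 0 -> 0 < x -> x <= y ->
  y `^ r <= x `^ r.
Proof.
move=> r0 x0 xy; rewrite -[r]opprK !(powRN _ (- r)).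
have y0 : 0 < y by exact: lt_le_trans xy.
rewrite lef_pV2 ?posrE ?powR_gt0//.
by rewrite ge0_ler_powR ?nnegrE ?oppr_ge0// ltW.
Qed.

Lemma powR_cvg (R : realType) (r x : R) : 0 < x -> y `^ r @[y --> x] --> x `^ r.
Proof.
move=> x0; have /derivable1_diffP := @ex_derive _ _ _ _ _ _ _ (is_derive1_powR r x0).
exact: differentiable_continuous.
Qed.

(** Joint convexity of [(s, F) |-> s^(p+1) F^(-p)], the perspective of the
    convex function [t^(-p)]: its graph lies above the tangent plane at
    [(s2, F2)].  After division by [s1 A2^(-p)], with [A_i = F_i / s_i], this is
    the tangent inequality at [w = A1 / A2]. *)
Lemma perspective_convex (R : realType) (p s1 s2 F1 F2 : R) :
  0 < p -> 0 < s1 -> 0 < s2 -> 0 < F1 -> 0 < F2 ->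
  s2 * (s2^-1 * F2) `^ (- p) - s1 * (s1^-1 * F1) `^ (- p) <=
  (p + 1) * (s2^-1 * F2) `^ (- p) * (s2 - s1) -
  p * (s2^-1 * F2) `^ (- p - 1) * (F2 - F1).
Proof.
move=> p0 s10 s20 F10 F20.
set A1 := s1^-1 * F1; set A2 := s2^-1 * F2.
have A10 : 0 < A1 by rewrite mulr_gt0 ?invr_gt0.
have A20 : 0 < A2 by rewrite mulr_gt0 ?invr_gt0.
have EF1 : F1 = s1 * A1 by rewrite mulVKf ?gt_eqF.
have EF2 : F2 = s2 * A2 by rewrite mulVKf ?gt_eqF.
have EA : A2 `^ (- p) = A2 `^ (- p - 1) * A2.
  by rewrite -{3}(powRr1 (ltW A20)) -powRD ?subrK// (gt_eqF A20) implybT.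
have EA1 : A1 `^ (- p) = A2 `^ (- p) * (A1 / A2) `^ (- p).
  rewrite -powRM ?(ltW A20) ?divr_ge0 ?(ltW A20) ?(ltW A10)//.
  by rewrite mulrC divfK// gt_eqF.
have := powR_tangent p0 (divr_gt0 A10 A20).
rewrite -(ler_pM2l (mulr_gt0 s10 (powR_gt0 (- p) A20))).
rewrite [leRHS]mulrDr -[s1 * _ * (A1 / A2) `^ _]mulrA -EA1.
have -> : s1 * A2 `^ (- p) * (p * (A1 / A2)) = p * A2 `^ (- p - 1) * F1.
  rewrite EA EF1; field; exact: lt0r_neq0.
rewrite {1}EF2.
have -> : p * A2 `^ (- p - 1) * (s2 * A2 - F1) =
    p * s2 * A2 `^ (- p) - p * A2 `^ (- p - 1) * F1.
  by rewrite EA; ring.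
lra.
Qed.

(** The tangent inequality at [w = h / (K * A)], multiplied by [A `^ (- p)]. *)
Lemma young_powR (R : realType) (p q K A h : R) :
  0 < q -> 0 < K -> 0 < A -> 0 < h ->
  (1 + q) * A `^ (- p) <=
  q / K * (A `^ (- p - 1) * h) + K `^ q * (A `^ (- p + q) * h `^ (- q)).
Proof.
move=> q0 K0 A0 h0.
have w0 : 0 < h / (K * A) by rewrite divr_gt0// mulr_gt0.
have := powR_tangent q0 w0.
rewrite -(ler_pM2r (powR_gt0 (- p) A0)) [leRHS]mulrDl => /le_trans; apply.
rewrite lerD//.
  have -> : A `^ (- p) = A `^ (- p - 1) * A.
    by rewrite -{3}(powRr1 (ltW A0)) -powRD ?subrK// (gt_eqF A0) implybT.
  rewrite le_eqVlt; apply/orP; left; apply/eqP; field.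
  by rewrite !gt_eqF.
have -> : (h / (K * A)) `^ (- q) = h `^ (- q) * (K `^ q * A `^ q).
  rewrite powRM ?invr_ge0 ?(ltW h0) ?mulr_ge0 ?(ltW K0) ?(ltW A0)//.
  rewrite -[K `^ q * A `^ q]powRM ?(ltW K0) ?(ltW A0)//.
  congr (_ * _).
  by rewrite -powR_inv1 ?mulr_ge0 ?(ltW K0) ?(ltW A0)// -powRrM mulN1r opprK.
rewrite [A `^ (- p + q)]powRD ?(gt_eqF A0) ?implybT//.
by rewrite le_eqVlt; apply/orP; left; apply/eqP; ring.
Qed.

Lemma powe_ge0 (R : realType) (x r : R) : (0 <= powe x r)%E.
Proof. by rewrite /powe; case: ifP => // _; rewrite ?leey// lee_fin powR_ge0. Qed.

Lemma powe_gt0E (R : realType) (x r : R) : 0 < x -> powe x r = (x `^ r)%:E.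
Proof. by move=> x0; rewrite /powe gt_eqF. Qed.

Lemma le_powe (R : realType) (x y r : R) : 0 <= x -> x <= y -> r <= 0 ->
  (powe y r <= powe x r)%E.
Proof.
move=> + xy r0; rewrite le_eqVlt => /predU1P[x0|x0]; last first.
  by rewrite !powe_gt0E ?(lt_le_trans x0)// lee_fin ler_powR_npos.
move: r0; rewrite le_eqVlt => /predU1P[->|r0].
  by rewrite /powe ltxx !andbF !powRr0.
by rewrite [leRHS]/powe -x0 eqxx r0 leey.
Qed.

Lemma measurable_powe (R : realType) (r : R) :
  measurable_fun [set: R] (fun x => powe x r).
Proof.
apply: measurable_fun_ifT => //.
  apply: measurable_and => //.
  exact: (@measurable_fun_eqr _ R R setT (fun x => x) (cst 0)).
by apply/measurable_EFinP; exact: measurable_powR.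
Qed.

Lemma measurable_powe_comp (R : realType) (r : R) (D : set R) (g : R -> R) :
  measurable_fun (D : set (lebT R)) g ->
  measurable_fun (D : set (lebT R)) (fun x => powe (g x) r).
Proof.
apply: (@measurableT_comp _ _ _ (lebT R) R _ (fun y => powe y r)).
exact: measurable_powe.
Qed.

(** At [x = 0] the limit is [+oo], which is the reason for the convention
    [powe 0 r = +oo]. *)
Lemma cvg_powe_shift (R : realType) (x r : R) : 0 <= x -> r < 0 ->
  powe (x + n.+1%:R^-1) r @[n --> \oo] --> powe x r.
Proof.
move=> + r0.
have h0 : (n.+1%:R^-1 : R) @[n --> \oo] --> (0 : R) by exact: cvg_harmonic.
rewrite le_eqVlt => /predU1P[<-|x0].
  rewrite [X in _ --> X]/powe eqxx r0/=.
  under eq_fun do rewrite add0r powe_gt0E//.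
  apply/cvgeryP/cvgryPge => M; near=> n.
  have M1 : 0 <= Num.max M 1 by rewrite le_max ler01 orbT.
  apply: (@le_trans _ _ (Num.max M 1)); first by rewrite le_max lexx.
  rewrite -powR_inv1// -powRrM mulN1r.
  have r'0 : 0 < - r by rewrite oppr_gt0.
  rewrite -[leLHS](powRr1 M1) -[X in _ `^ X <= _](mulVf (lt0r_neq0 r'0)) powRrM.
  apply: ge0_ler_powR; rewrite ?nnegrE ?powR_ge0 ?(ltW r'0)//.
  apply: (@le_trans _ _ n%:R); last by rewrite ler_nat.
  by near: n; exact: nbhs_infty_ger.
rewrite powe_gt0E//.
under eq_fun do rewrite powe_gt0E ?addr_gt0//.
apply: cvg_EFin; first exact: nearW.
apply: (@cvg_comp _ _ _ (fun n => x + n.+1%:R^-1) (fun y => y `^ r) _ (nbhs x)).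
  suff : x + n.+1%:R^-1 @[n --> \oo] --> x + 0 by rewrite addr0.
  by apply: cvgD => //; exact: cvg_cst.
by apply: powR_cvg.
Unshelve. all: by end_near. Qed.

(** * The average of an integrable function *)

(** Absolute continuity of the integral: the measure of the interval between [x]
    and [y] tends to [0]. *)
Lemma primitive_cvg (R : realType) (a b x : R) (h : R -> R) :
  nu.-integrable `[a, b] (EFin \o h) -> a <= x <= b ->
  \int[nu]_(t in `[a, y]) h t @[y --> within `[a, b] (nbhs x)] -->
  \int[nu]_(t in `[a, x]) h t.
Proof.
move=> ih /andP[ax xb].
have mi (i : interval R) : measurable ([set` i] : set (lebT R)).
  by apply: borel_lebT.
have ihT : nu.-integrable setT (EFin \o (h \_ `[a, b])).
  by rewrite -restrict_EFin; apply/integrable_restrict => //; rewrite setTI.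
apply/cvgrPdist_lt => e e0.
have [d [d0 smalld]] := integral_normr_continuous ihT e0.
have small u v : a <= u -> u <= v -> v <= b -> v - u < d ->
    `|\int[nu]_(t in `[a, v]) h t - \int[nu]_(t in `[a, u]) h t| < e.
  move=> au uv vb vud.
  have sv : `[a, v] `<=` `[a, b]%classic by apply: subset_itvl; rewrite bnd_simp.
  have suv : `]u, v] `<=` `[a, b]%classic by apply: subset_itv; rewrite bnd_simp.
  rewrite (@Rintegral_nu_itv_split _ (BLeft a) u v) ?bnd_simp//; last first.
    by apply: integrableS ih => //.
  rewrite addrC addKr (le_lt_trans (le_normr_Rintegral _ _))//.
    by apply: integrableS ih.
  rewrite (@eq_Rintegral _ (lebT R) _ _ _ (fun t => `|(h \_ `[a, b]) t|)); last first.
    by move=> t /set_mem tuv; rewrite patchE mem_set//; exact: suv.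
  apply: smalld; first exact: mi.
  rewrite [X in (X < _)%E](_ : _ = lebesgue_measure `]u, v]%classic)//.
  rewrite lebesgue_measure_itv/= lte_fin; case: ifPn => _.
    by rewrite -EFinD lte_fin.
  by rewrite lte_fin.
rewrite near_withinE; near=> y => /=; rewrite in_itv/= => /andP[ay yb].
have yd : `|x - y| < d by near: y; exact: nbhsx_ballx.
have [xy|yx] := leP x y.
  rewrite distrC; apply: small => //.
  by rewrite -(ger0_norm (x := y - x)) ?subr_ge0// distrC.
apply: small => //; first exact: ltW.
by rewrite -(gtr0_norm (x := x - y)) ?subr_gt0.
Unshelve. all: by end_near. Qed.

Lemma avg_cvg (R : realType) (a b x : R) (h : R -> R) :
  nu.-integrable `[a, b] (EFin \o h) -> a < x <= b ->
  avg a h y @[y --> within `[a, b] (nbhs x)] --> avg a h x.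
Proof.
move=> ih /andP[ax xb]; apply: cvgM; last first.
  by apply: (primitive_cvg ih); rewrite (ltW ax).
apply: cvg_within_filter; apply: cvgV; first by rewrite subr_eq0 gt_eqF.
by apply: cvgB => //; exact: cvg_cst.
Qed.

Lemma measurable_avg (R : realType) (a b : R) (h : R -> R) :
  nu.-integrable `[a, b] (EFin \o h) ->
  measurable_fun (`]a, b] : set (lebT R)) (avg a h).
Proof.
move=> ih.
have mavg : measurable_fun `]a, b] (avg a h).
  apply: subspace_continuous_measurable_fun => //.
  apply/subspace_continuousP => x; rewrite /= in_itv/= => xab.
  apply: cvg_trans (avg_cvg ih xab); apply: cvg_app; apply: within_subset.
  by apply: subset_itv; rewrite bnd_simp.
exact: measurable_fun_lebT mavg.
Qed.

Lemma avg_ge (R : realType) (a b eps : R) (h : R -> R) :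
  nu.-integrable `[a, b] (EFin \o h) ->
  (forall x, a <= x <= b -> eps <= h x) ->
  forall x, a < x <= b -> eps <= avg a h x.
Proof.
move=> ih heps x /andP[ax xb].
have xa : 0 < x - a by rewrite subr_gt0.
rewrite /avg mulrC ler_pdivlMr//.
rewrite -(Rintegral_nu_cst true eps (ltW ax)).
apply: le_Rintegral => //.
- exact: integrable_cst_nu.
- by apply: integrableS ih => //; apply: subset_itvl; rewrite bnd_simp.
- move=> y; rewrite /= in_itv/= => /andP[ay yx]; apply: heps.
  by rewrite ay (le_trans yx).
Qed.

Lemma avg_addc (R : realType) (a b k x : R) (f : R -> R) :
  nu.-integrable `[a, b] (EFin \o f) -> a < x <= b ->
  avg a (fun y => f y + k) x = avg a f x + k.
Proof.
move=> fi /andP[ax xb]; rewrite /avg.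
rewrite -[in RHS](mulrK (_ : x - a \is a GRing.unit) k); last first.
  by rewrite unitfE subr_eq0 gt_eqF.
rewrite -(Rintegral_nu_cst true k (ltW ax)) (@RintegralD _ (lebT R) R nu)//.
- by rewrite mulrDr [_ / _]mulrC.
- by apply: integrableS fi => //; apply: subset_itvl; rewrite bnd_simp.
- exact: integrable_cst_nu.
Qed.

Lemma measurable_integrand (R : realType) (a b r s : R) (f : R -> R) :
  nu.-integrable `[a, b] (EFin \o f) ->
  measurable_fun (`]a, b] : set (lebT R))
    (fun x => powe (avg a f x) r * powe (f x) s)%E.
Proof.
move=> fi; apply: (@emeasurable_funM _ (lebT R)).
  exact/measurable_powe_comp/measurable_avg/fi.
apply: measurable_powe_comp.
apply: (@measurable_funS _ _ (lebT R) R `[a, b]%classic) => //.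
  by apply: subset_itvr; rewrite bnd_simp.
by apply/measurable_EFinP; exact: measurable_int fi.
Qed.

Lemma integrable_powR_avg (R : realType) (a b eps r c : R) (h : R -> R) :
  0 < eps -> nu.-integrable `[a, b] (EFin \o h) ->
  (forall x, a <= x <= b -> eps <= h x) -> a <= c -> r <= 0 ->
  nu.-integrable `]c, b]
     (EFin \o (fun x => avg a h x `^ r)) /\
  nu.-integrable `]c, b]
     (EFin \o (fun x => avg a h x `^ r * h x)).
Proof.
move=> eps0 ih heps ac r0.
have mA : measurable_fun (`]c, b]%classic : set (lebT R)) (fun x => avg a h x `^ r).
  apply: (@measurableT_comp _ _ _ (lebT R) R R (fun y => y `^ r)).
    exact: measurable_powR.
  apply: measurable_funS (measurable_avg ih) => //.
  by apply: subset_itvr; rewrite bnd_simp.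
have leA x : c < x <= b -> `|avg a h x `^ r| <= eps `^ r.
  move=> /andP[cx xb]; rewrite ger0_norm ?powR_ge0//.
  by apply: ler_powR_npos => //; apply: (avg_ge ih heps); rewrite (le_lt_trans ac).
split; first exact: bounded_integrable_nu leA.
apply: (@integrableMr _ (lebT R) R nu `]c, b]%classic _ _ (EFin \o h)) => //.
  exists (eps `^ r); split => // N MN x; rewrite /= in_itv/= => xcb.
  by rewrite (le_trans (leA _ xcb))// ltW.
by apply: integrableS ih => //; apply: subset_itv; rewrite bnd_simp.
Qed.

Lemma integrable_rhs (R : realType) (a b eps p q : R) (h : R -> R) :
  0 < q -> q <= p -> 0 < eps ->
  nu.-integrable `[a, b] (EFin \o h) ->
  (forall x, a <= x <= b -> eps <= h x) ->
  nu.-integrable `]a, b]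
     (EFin \o (fun x => avg a h x `^ (- p + q) * h x `^ (- q))).
Proof.
move=> q0 qp eps0 ih heps.
have sab : `]a, b] `<=` `[a, b]%classic by apply: subset_itvr; rewrite bnd_simp.
apply: (@bounded_integrable_nu _ a b (eps `^ (- p + q) * eps `^ (- q))).
  apply: (@measurable_funM _ (lebT R)).
    apply: (@measurableT_comp _ _ _ (lebT R) R R (fun y => y `^ (- p + q))).
      exact: measurable_powR.
    exact: measurable_avg ih.
  apply: (@measurableT_comp _ _ _ (lebT R) R R (fun y => y `^ (- q))).
    exact: measurable_powR.
  apply: (@measurable_funS _ _ (lebT R) R `[a, b]%classic) => //.
  by apply/measurable_EFinP; exact: measurable_int ih.
move=> x /andP[ax xb]; rewrite ger0_norm ?mulr_ge0 ?powR_ge0//.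
apply: ler_pM; rewrite ?powR_ge0//; apply: ler_powR_npos => //.
- by rewrite addrC subr_le0.
- by apply: (avg_ge ih heps); rewrite ax.
- by rewrite oppr_le0 ltW.
- by apply: heps; rewrite xb ltW.
Qed.

(** * The inequality for functions bounded away from zero *)

(** Continuity at [x] only controls how nearby values compare with the one at
    [x], not with each other, hence this form of the hypothesis.  A supremum
    argument glues these comparisons. *)
Lemma locally_nondecreasing_le (R : realType) (D : R -> R) (c b : R) : c <= b ->
  (forall x, c <= x <= b -> \forall y \near x, c <= y <= b ->
     (y <= x -> D y <= D x) /\ (x <= y -> D x <= D y)) ->
  D c <= D b.
Proof.
move=> cb loc.
pose S := [set x | c <= x <= b /\ D c <= D x].
have Sc : S c by split; rewrite ?lexx.
have ubS : ubound S b by move=> x [/andP[]].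
have hsS : has_sup S by split; [exists c|exists b].
have cs : c <= sup S by apply: ub_le_sup => //; exact: hsS.2.
have sb : sup S <= b by apply: ge_sup => //; exists c.
have /nbhs_ballP[d /= d0 sd] := loc (sup S) (introT andP (conj cs sb)).
(* The supremum is attained in [S], and cannot be smaller than [b]. *)
have Ds : D c <= D (sup S).
  have [x [/andP[cx xb] Dx] sx] := sup_adherent d0 hsS.
  have xs : x <= sup S by apply: ub_le_sup; [exact: hsS.2|split; rewrite ?cx].
  have [||+ _] := sd x; rewrite ?cx//.
    by rewrite /ball/= ger0_norm ?subr_ge0// ltrBlDr -ltrBlDl.
  by move=> /(_ xs); exact: le_trans.
move: sb; rewrite le_eqVlt => /predU1P[<-//|sb].
pose y := Num.min b (sup S + d / 2).
have sy : sup S < y by rewrite lt_min sb ltrDl divr_gt0.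
have yb : y <= b by rewrite ge_min lexx.
have cy : c <= y by rewrite (le_trans cs)// ltW.
have [||_ /(_ (ltW sy)) Dsy] := sd y; rewrite ?cy//.
  rewrite /ball/= distrC ger0_norm ?subr_ge0 1?ltW//.
  rewrite ltrBlDl (@le_lt_trans _ _ (sup S + d / 2))//.
    by rewrite ge_min lexx orbT.
  by rewrite ltrD2l ltr_pdivrMr// ltr_pMr// ltr1n.
have : y <= sup S.
  apply: ub_le_sup; first exact: hsS.2.
  by split; [rewrite cy|exact: le_trans Dsy].
by rewrite leNgt sy.
Qed.

(** Integration of [(p + 1) A^(-p) - p A^(-p-1) h], the formal derivative of
    [Psi = (x - a) A^(-p)], between [c] and [b].  The bound
    [(c - a) eps^(-p)] on [Psi c] vanishes as [c] tends to [a]. *)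
Lemma energy_le (R : realType) (a b eps p c : R) (h : R -> R) :
  0 < p -> 0 < eps ->
  nu.-integrable `[a, b] (EFin \o h) ->
  (forall x, a <= x <= b -> eps <= h x) -> a < c -> c <= b ->
  p * \int[nu]_(x in `]c, b]) (avg a h x `^ (- p - 1) * h x) <=
  (p + 1) * \int[nu]_(x in `]c, b]) (avg a h x `^ (- p)) +
  (c - a) * eps `^ (- p).
Proof.
move=> p0 eps0 ih heps ac cb.
have np : - p <= 0 by rewrite oppr_le0 ltW.
have np1 : - p - 1 <= 0 by lra.
pose A := avg a h.
have [i1 _] := integrable_powR_avg eps0 ih heps (ltW ac) np.
have [_ i2] := integrable_powR_avg eps0 ih heps (ltW ac) np1.
have ih' : nu.-integrable `]c, b] (EFin \o h).
  by apply: integrableS ih => //; apply: subset_itv; rewrite bnd_simp// ltW.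
have i3 : nu.-integrable `]c, b] (EFin \o cst (1 : R)).
  exact: integrable_cst_nu.
pose g x := (p + 1) * A x `^ (- p) - p * (A x `^ (- p - 1) * h x).
pose m x := (p + 1) * 1 + p * h x.
have ig : nu.-integrable `]c, b] (EFin \o g).
  apply: (@integrableB _ (lebT R) R nu _ _
    (fun x => ((p + 1) * A x `^ (- p))%:E)
    (fun x => (p * (A x `^ (- p - 1) * h x))%:E)) => //.
    exact: (integrableZl _ (p + 1) i1).
  exact: (integrableZl _ p i2).
have im : nu.-integrable `]c, b] (EFin \o m).
  apply: (@integrableD _ (lebT R) R nu _ _ (fun x => ((p + 1) * 1)%:E)
    (fun x => (p * h x)%:E)) => //.
    exact: (integrableZl _ (p + 1) i3).
  exact: (integrableZl _ p ih').
pose Psi x := (x - a) * A x `^ (- p).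
have Apos x : a < x <= b -> 0 < A x.
  by move=> xab; apply: (lt_le_trans eps0); exact: (avg_ge ih heps).
have hpos x : a <= x <= b -> 0 < h x.
  by move=> xab; apply: (lt_le_trans eps0); exact: heps.
(* [m] is what a perturbation of size [eta] of both powers of [A] can cost;
   [eta] tends to [0] at the end. *)
have key (eta : R) : 0 < eta ->
    Psi b - Psi c <=
    \int[nu]_(x in `]c, b]) g x + eta * \int[nu]_(x in `]c, b]) m x.
  move=> eta0.
  pose k x := g x + eta * m x.
  have ik : nu.-integrable `]c, b] (EFin \o k).
    apply: (@integrableD _ (lebT R) R nu _ _ (EFin \o g)
      (fun x => (eta * m x)%:E)) => //.
    exact: (integrableZl _ eta im).
  have -> : \int[nu]_(x in `]c, b]) g x + eta * \int[nu]_(x in `]c, b]) m x =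
      \int[nu]_(x in `]c, b]) k x.
    by rewrite -RintegralZl// -RintegralD//; exact: (integrableZl _ eta im).
  pose D x := \int[nu]_(t in `]c, x]) k t - Psi x.
  suff : D c <= D b.
    rewrite /D set_itvoc0 Rintegral_set0.
    by rewrite sub0r lerBrDl.
  (* On an interval where [A] hardly varies, freeze [A] at the right endpoint:
     the frozen integrand [l] is below [k], and its integral is the right-hand
     side of [perspective_convex]. *)
  have incr u v : c <= u -> u <= v -> v <= b ->
      (forall t, u < t -> t <= v -> `|A v `^ (- p) - A t `^ (- p)| <= eta /\
        `|A v `^ (- p - 1) - A t `^ (- p - 1)| <= eta) -> D u <= D v.
    move=> cu uv vb osc.
    have av : a < v <= b by rewrite vb (lt_le_trans ac)// (le_trans cu).
    have au : a < u <= b by rewrite (le_trans uv vb) (lt_le_trans ac).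
    have suv : `]u, v] `<=` `]c, b]%classic by apply: subset_itv; rewrite bnd_simp.
    have ihv : nu.-integrable `[a, v] (EFin \o h).
      by apply: integrableS ih => //; apply: subset_itvl; rewrite bnd_simp.
    have ihuv : nu.-integrable `]u, v] (EFin \o h).
      exact: integrableS ih'.
    have ikv : nu.-integrable `]c, v] (EFin \o k).
      by apply: integrableS ik => //; apply: subset_itvl; rewrite bnd_simp.
    have Ek : \int[nu]_(t in `]c, v]) k t =
        \int[nu]_(t in `]c, u]) k t + \int[nu]_(t in `]u, v]) k t.
      exact: (@Rintegral_nu_itv_split R (BRight c) u v k ikv cu uv).
    have Eh : \int[nu]_(t in `[a, v]) h t =
        \int[nu]_(t in `[a, u]) h t + \int[nu]_(t in `]u, v]) h t.
      apply: (@Rintegral_nu_itv_split R (BLeft a) u v h ihv _ uv).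
      by rewrite bnd_simp; case/andP: au => /ltW.
    pose l t := (p + 1) * A v `^ (- p) - p * A v `^ (- p - 1) * h t.
    have lk : \int[nu]_(t in `]u, v]) l t <= \int[nu]_(t in `]u, v]) k t.
      apply: le_Rintegral => //.
      - apply: (@integrableB _ (lebT R) R nu _ _
          (fun x => ((p + 1) * A v `^ (- p))%:E)
          (fun x => (p * A v `^ (- p - 1) * h x)%:E)) => //.
          exact: integrable_cst_nu.
        exact: (integrableZl _ (p * A v `^ (- p - 1)) ihuv).
      - exact: integrableS ik.
      - move=> t tuv; have := suv _ tuv.
        move: tuv; rewrite /= !in_itv/= => /andP[ut tv] /andP[ct tb].
        have ht : 0 < h t by rewrite hpos// tb ltW// (lt_trans ac).
        have [] := osc _ ut tv.
        rewrite !ler_norml => /andP[_ osc1] /andP[osc2 _].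
        have := ler_wpM2l (ltW (ltr_wpDl ler01 p0)) osc1.
        have := ler_wpM2l (ltW (mulr_gt0 p0 ht)) osc2.
        rewrite /l /k /g /m.
        move: (A v `^ _) (A v `^ _) (A t `^ _) (A t `^ _) (h t).
        clear => *; lra.
    have El : \int[nu]_(t in `]u, v]) l t =
        (p + 1) * A v `^ (- p) * ((v - a) - (u - a)) -
        p * A v `^ (- p - 1) *
          (\int[nu]_(t in `[a, v]) h t - \int[nu]_(t in `[a, u]) h t).
      rewrite RintegralB//; last 2 first.
      - exact: integrable_cst_nu.
      - exact: (integrableZl _ (p * A v `^ (- p - 1)) ihuv).
      have := Rintegral_nu_cst false ((p + 1) * A v `^ (- p)) uv => ->.
      have mi := @measurable_itv_lebT R `]u, v].
      have := @RintegralZl _ (lebT R) R nu _ h (p * A v `^ (- p - 1)) mi ihuv => ->.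
      rewrite Eh [_ + _ - Rintegral _ _ _]addrC addKr.
      by congr (_ * _ - _); rewrite opprB addrA subrK.
    have Fpos y : a < y <= b -> 0 < \int[nu]_(t in `[a, y]) h t.
      move=> /[dup] ayb /andP[ay _]; have := Apos _ ayb.
      by rewrite /A /avg pmulr_rgt0// invr_gt0 subr_gt0.
    have sa y : a < y <= b -> 0 < y - a by move=> /andP[ay _]; rewrite subr_gt0.
    have := perspective_convex p0 (sa _ au) (sa _ av) (Fpos _ au) (Fpos _ av).
    rewrite -!/(avg a h _) -/A -El -!/(Psi _) => conv.
    rewrite /D Ek; move: (Psi v) (Psi u) lk conv.
    move: (Rintegral _ _ _) (Rintegral _ _ _) (Rintegral _ _ _).
    clear => *; lra.
  apply: locally_nondecreasing_le => // x /andP[cx xb].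
  have axb : a < x <= b by rewrite xb (lt_le_trans ac).
  have osc r : \forall y \near within `[a, b] (nbhs x),
      `|A x `^ r - A y `^ r| <= eta / 2.
    have : (A y `^ r) @[y --> within `[a, b] (nbhs x)] --> A x `^ r.
      apply: (@cvg_comp _ _ _ A (fun y => y `^ r)).
        exact: avg_cvg.
      by apply: powR_cvg; exact: Apos.
    by move/cvgrPdist_le; apply; rewrite divr_gt0.
  have := osc (- p); have := osc (- p - 1).
  rewrite !near_withinE => /nbhs_ballP[d1 /= d10 osc1] /nbhs_ballP[d2 /= d20 osc2].
  pose d := Num.min d1 d2.
  have d0 : 0 < d by rewrite lt_min d10.
  have close s t : c <= s <= b -> c <= t <= b -> `|x - s| < d -> `|x - t| < d ->
      `|A s `^ (- p) - A t `^ (- p)| <= eta /\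
      `|A s `^ (- p - 1) - A t `^ (- p - 1)| <= eta.
    have aux (X S T : R) : `|X - S| <= eta / 2 -> `|X - T| <= eta / 2 ->
        `|S - T| <= eta.
      move=> ? ?; rewrite (le_trans (ler_distD X _ _))// (splitr eta) lerD//.
      by rewrite distrC.
    move=> /andP[cs sb] /andP[ct tb].
    rewrite !lt_min => /andP[s1 s2] /andP[t1 t2].
    split.
      apply: (aux (A x `^ (- p))); apply: osc2 => //;
        rewrite in_itv/= ?sb ?tb andbT.
        exact: le_trans (ltW ac) _.
      exact: le_trans (ltW ac) _.
    apply: (aux (A x `^ (- p - 1))); apply: osc1 => //;
      rewrite in_itv/= ?sb ?tb andbT.
      exact: le_trans (ltW ac) _.
    exact: le_trans (ltW ac) _.
  near=> y => /andP[cy yb].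
  have yd : `|x - y| < d by near: y; exact: nbhsx_ballx.
  have xd : `|x - x| < d by rewrite subrr normr0.
  split=> [yx|xy].
    apply: incr => // t yt tx; apply: close => //; rewrite ?cx ?xb//.
      by rewrite (le_trans cy (ltW yt)) (le_trans tx).
    apply: le_lt_trans yd; rewrite !ger0_norm ?subr_ge0// lerD2l lerN2.
    exact: ltW.
  apply: incr => // t xt ty; apply: close => //; rewrite ?cy ?yb//.
    by rewrite (le_trans cx (ltW xt)) (le_trans ty).
  apply: le_lt_trans yd; rewrite distrC [leRHS]distrC
    !ger0_norm ?subr_ge0// ?(ltW xt)//.
  by rewrite lerD2r.
have Psib : 0 <= Psi b.
  by rewrite mulr_ge0 ?powR_ge0// subr_ge0 (le_trans (ltW ac)).
have Psic : Psi c <= (c - a) * eps `^ (- p).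
  rewrite ler_wpM2l ?subr_ge0 ?(ltW ac)// ler_powR_npos//.
  by apply: (avg_ge ih heps); rewrite ac.
have Ig : \int[nu]_(x in `]c, b]) g x =
    (p + 1) * \int[nu]_(x in `]c, b]) (avg a h x `^ (- p)) -
    p * \int[nu]_(x in `]c, b]) (avg a h x `^ (- p - 1) * h x).
  rewrite RintegralB//; last 2 first.
  - exact: (integrableZl _ (p + 1) i1).
  - exact: (integrableZl _ p i2).
  by rewrite !RintegralZl.
suff : Psi b - Psi c <= \int[nu]_(x in `]c, b]) g x.
  rewrite Ig; move: (Psi b) (Psi c) Psib Psic.
  move: (Rintegral _ _ _) (Rintegral _ _ _) (eps `^ _).
  by clear => *; lra.
set M := \int[nu]_(x in `]c, b]) m x in key.
have M0 : 0 <= M.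
  apply: Rintegral_ge0 => x; rewrite /= in_itv/= => /andP[cx xb].
  have : 0 < h x by rewrite hpos// xb ltW// (lt_trans ac).
  by move=> h0; rewrite /m addr_ge0// mulr_ge0 ?addr_ge0 ?ltW.
apply/ler_addgt0Pr => e e0.
have M1 : 0 < M + 1 by rewrite ltr_wpDl.
apply: le_trans (key (e / (M + 1)) _) _; first by rewrite divr_gt0.
by rewrite lerD2l mulrAC ler_pdivrMr// ler_pM2l// lerDl.
Unshelve. all: by end_near. Qed.

(** Young's inequality is integrated from [c] to [b], where [energy_le] is
    available; what is lost between [a] and [c] is of order [c - a]. *)
Lemma hardy_bounded_below (R : realType) (a b eps p q : R) (h : R -> R) :
  a < b -> 0 < q -> q <= p -> 0 < eps ->
  nu.-integrable `[a, b] (EFin \o h) ->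
  (forall x, a <= x <= b -> eps <= h x) ->
  \int[nu]_(x in `]a, b]) (avg a h x `^ (- p)) <=
  ((p + 1) / p) `^ q *
    \int[nu]_(x in `]a, b]) (avg a h x `^ (- p + q) * h x `^ (- q)).
Proof.
move=> ab q0 qp eps0 ih heps.
have p0 : 0 < p by exact: lt_le_trans qp.
have np : - p <= 0 by rewrite oppr_le0 ltW.
have np1 : - p - 1 <= 0 by rewrite subr_le0 (le_trans np).
have K0 : 0 < (p + 1) / p by rewrite divr_gt0// addr_gt0.
set K := (p + 1) / p in K0 *.
have mi (u v : R) := @measurable_itv_lebT R `]u, v].
have [iA _] := integrable_powR_avg eps0 ih heps (lexx a) np.
have [_ iE] := integrable_powR_avg eps0 ih heps (lexx a) np1.
have iQ := integrable_rhs q0 qp eps0 ih heps.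
pose fA x := avg a h x `^ (- p).
pose fE x := avg a h x `^ (- p - 1) * h x.
pose fQ x := avg a h x `^ (- p + q) * h x `^ (- q).
rewrite -/fA -/fQ.
have bnd c : a < c -> c <= b -> \int[nu]_(x in `]a, b]) fA x <=
    K `^ q * \int[nu]_(x in `]a, b]) fQ x +
    (c - a) * (eps `^ (- p) * (1 + q / (p + 1))).
  move=> ac cb.
  have scb : `]c, b] `<=` `]a, b]%classic.
    by apply: subset_itvr; rewrite bnd_simp ltW.
  have sac : `]a, c] `<=` `]a, b]%classic by apply: subset_itvl; rewrite bnd_simp.
  have iAc : nu.-integrable `]c, b] (EFin \o fA).
    exact: integrableS iA.
  have iEc : nu.-integrable `]c, b] (EFin \o fE).
    exact: integrableS iE.
  have iQc : nu.-integrable `]c, b] (EFin \o fQ).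
    exact: integrableS iQ.
  have EA := @Rintegral_nu_itv_split R (BRight a) c b fA iA (ltW ac) cb.
  have EQ := @Rintegral_nu_itv_split R (BRight a) c b fQ iQ (ltW ac) cb.
  have QA : 0 <= \int[nu]_(x in `]a, c]) fQ x.
    by apply: Rintegral_ge0 => x _; rewrite mulr_ge0 ?powR_ge0.
  have AA : \int[nu]_(x in `]a, c]) fA x <= eps `^ (- p) * (c - a).
    rewrite -(Rintegral_nu_cst false (eps `^ (- p)) (ltW ac)).
    apply: le_Rintegral => //.
    - exact: integrableS iA.
    - exact: integrable_cst_nu.
    move=> x; rewrite /= in_itv/= => /andP[ax xc].
    by apply: ler_powR_npos => //; apply: (avg_ge ih heps); rewrite ax (le_trans xc).
  have en := energy_le p0 eps0 ih heps ac cb.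
  rewrite -/(fE _) -/(fA _) in en.
  have yg : (1 + q) * \int[nu]_(x in `]c, b]) fA x <=
      q / K * \int[nu]_(x in `]c, b]) fE x +
      K `^ q * \int[nu]_(x in `]c, b]) fQ x.
    have eA := @RintegralZl _ (lebT R) R nu _ fA (1 + q) (mi c b) iAc.
    have eE := @RintegralZl _ (lebT R) R nu _ fE (q / K) (mi c b) iEc.
    have eQ := @RintegralZl _ (lebT R) R nu _ fQ (K `^ q) (mi c b) iQc.
    rewrite -eA -eE -eQ.
    have iE' := integrableZl (mi c b) (q / K) iEc.
    have iQ' := integrableZl (mi c b) (K `^ q) iQc.
    have eD := @RintegralD _ (lebT R) R nu `]c, b]%classic (fun x => q / K * fE x)
      (fun x => K `^ q * fQ x) (mi c b) iE' iQ'.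
    rewrite -eD; apply: le_Rintegral => //.
    - exact: (integrableZl (mi c b) (1 + q) iAc).
    - exact: (integrableD (mi c b) iE' iQ').
    move=> x; rewrite /= in_itv/= => /andP[cx xb].
    have ax : a < x by exact: lt_trans cx.
    apply: young_powR => //; apply: (lt_le_trans eps0).
      by apply: (avg_ge ih heps); rewrite ax.
    by apply: heps; rewrite xb ltW.
  have t0 : 0 <= q / (p + 1) by rewrite divr_ge0 ?ltW// addr_gt0.
  have tp : q / (p + 1) * (p + 1) = q by rewrite divfK// gt_eqF// addr_gt0.
  have qK : q / K = q / (p + 1) * p by rewrite /K invf_div mulrA mulrAC.
  have := ler_wpM2l t0 en.
  have KQ : 0 <= K `^ q * \int[nu]_(x in `]a, c]) fQ x.
    by rewrite mulr_ge0 ?powR_ge0.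
  rewrite mulrDr [_ / _ * (_ * \int[nu]_(x in _) fA x)]mulrA tp.
  move: yg; rewrite EA EQ qK; move: KQ AA.
  move: (Rintegral nu _ _) (Rintegral nu _ _) (Rintegral nu _ _).
  move: (Rintegral nu _ _) (Rintegral nu _ _).
  move: (q / (p + 1)) (K `^ q) (eps `^ _).
  clear => *; lra.
have C0 : 0 < eps `^ (- p) * (1 + q / (p + 1)).
  by rewrite mulr_gt0 ?powR_gt0// addr_gt0// divr_gt0// addr_gt0.
set C := eps `^ (- p) * _ in C0 bnd.
apply/ler_addgt0Pr => e e0.
pose c := a + Num.min (b - a) (e / C).
apply: le_trans (bnd c _ _) _.
- by rewrite ltrDl lt_min subr_gt0 ab divr_gt0.
- by rewrite -lerBrDl ge_min lexx.
- by rewrite lerD2l /c addrAC subrr add0r -ler_pdivlMr// ge_min lexx orbT.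
Qed.

(** * The inequality in general *)

(** Adding a positive constant to [f] makes the right-hand side smaller, so the
    inequalities for [f + 1 / n.+1] have a common bound and monotone convergence
    applies to their left-hand sides. *)
Lemma hardy_inequality (R : realType) (a b p q : R) (f : R -> R) :
  a < b -> 0 < q -> q <= p ->
  (forall x, x \in `[a, b] -> 0 <= f x) ->
  nu.-integrable `[a, b] (EFin \o f) ->
  (\int[nu]_(x in `[a, b]) powe (avg a f x) (- p) <=
   (((p + 1) / p) `^ q)%:E *
     \int[nu]_(x in `[a, b])
       (powe (avg a f x) (- p + q) * powe (f x) (- q)))%E.
Proof.
move=> ab q0 qp f0 fi.
have p0 : 0 < p by exact: lt_le_trans qp.
have np : - p < 0 by rewrite oppr_lt0.
have nq : - q <= 0 by rewrite oppr_le0 ltW.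
have npq : - p + q <= 0 by rewrite addrC subr_le0.
have f0' x : a <= x <= b -> 0 <= f x by move=> xab; apply: f0; rewrite in_itv.
have A0 x : a < x <= b -> 0 <= avg a f x by exact: (avg_ge fi f0').
have mab := @measurable_itv_lebT R `]a, b].
have mA := measurable_powe_comp (- p) (measurable_avg fi).
have mQ := measurable_integrand (- p + q) (- q) fi.
rewrite (integral_nu_obnd_cbnd (ltW ab) mA); last first.
  by move=> x _; exact: powe_ge0.
rewrite (integral_nu_obnd_cbnd (ltW ab) mQ); last first.
  by move=> x _; rewrite mule_ge0 ?powe_ge0.
pose e n : R := n.+1%:R^-1.
have e0 n : 0 < e n by rewrite invr_gt0.
have step n : (\int[nu]_(x in `]a, b]) powe (avg a f x + e n) (- p) <=
   (((p + 1) / p) `^ q)%:E *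
     \int[nu]_(x in `]a, b]) (powe (avg a f x) (- p + q) * powe (f x) (- q)))%E.
  pose h x := f x + e n.
  have ih : nu.-integrable `[a, b] (EFin \o h).
    apply: (@integrableD _ (lebT R) R nu _ _ (EFin \o f) (fun=> (e n)%:E)) => //.
    exact: integrable_cst_nu.
  have eh x : a <= x <= b -> e n <= h x by move=> /f0'; rewrite /h lerDr.
  have avgh x : a < x <= b -> avg a h x = avg a f x + e n.
    exact: avg_addc fi.
  have [iA _] := integrable_powR_avg (e0 n) ih eh (lexx a) (ltW np).
  have iQ := integrable_rhs q0 qp (e0 n) ih eh.
  have := hardy_bounded_below ab q0 qp (e0 n) ih eh.
  rewrite -lee_fin EFinM /Rintegral !fineK; last 2 first.
  - exact: integrable_fin_num iQ.
  - exact: integrable_fin_num iA.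
  move=> hb.
  have -> : (\int[nu]_(x in `]a, b]) powe (avg a f x + e n) (- p) =
      \int[nu]_(x in `]a, b]) (avg a h x `^ (- p))%:E)%E.
    apply: eq_integral => x /set_mem; rewrite /= in_itv/= => xab.
    by rewrite powe_gt0E ?avgh// ltr_wpDl// A0.
  apply: le_trans hb _.
  rewrite lee_wpmul2l ?lee_fin ?powR_ge0//.
  apply: (@ge0_le_integral _ (lebT R) R nu) => //.
  - by move=> x _; rewrite lee_fin mulr_ge0 ?powR_ge0.
  - exact: (measurable_int nu iQ).
  move=> x; rewrite /= in_itv/= => /andP[ax xb].
  have xab : a < x <= b by rewrite ax.
  have xab' : a <= x <= b by rewrite ltW.
  rewrite EFinM lee_pmul ?lee_fin ?powR_ge0//.
    rewrite -powe_gt0E ?avgh ?ltr_wpDl ?A0//.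
    by apply: le_powe; rewrite ?A0// lerDl ltW.
  rewrite -powe_gt0E /h ?ltr_wpDl ?f0'//.
  by apply: le_powe; rewrite ?f0'// lerDl ltW.
have nd x : a < x <= b ->
    {homo (fun n => powe (avg a f x + e n) (- p)) : n m / (n <= m)%N >->
      (n <= m)%E}.
  move=> xab n m nm; apply: le_powe; rewrite ?addr_ge0 ?A0 ?(ltW (e0 _))//;
    last exact: ltW.
  by rewrite lerD2l lef_pV2 ?posrE// ler_nat.
have mAe n : measurable_fun (`]a, b] : set (lebT R))
    (fun x => powe (avg a f x + e n) (- p)).
  apply: measurable_powe_comp; apply: (@measurable_funD _ (lebT R)).
    exact: measurable_avg fi.
  exact: measurable_cst.
have -> : (\int[nu]_(x in `]a, b]) powe (avg a f x) (- p) =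
    \int[nu]_(x in `]a, b]) limn (fun n => powe (avg a f x + e n) (- p)))%E.
  apply: eq_integral => x /set_mem; rewrite /= in_itv/= => xab.
  by apply/esym/cvg_lim => //; apply: cvg_powe_shift => //; exact: A0.
rewrite (@monotone_convergence _ (lebT R) R nu)//; last first.
  by move=> n x _; exact: powe_ge0.
apply: lime_le; last by apply: nearW.
apply: ereal_nondecreasing_is_cvgn => n m nm.
apply: (@ge0_le_integral _ (lebT R) R nu) => //.
- by move=> x _; exact: powe_ge0.
- by move=> x; rewrite /= in_itv/= => /nd; exact.
Qed.

(** * Sharpness *)

Lemma is_derive_shift_powR (R : realType) (a g y : R) : a < y ->
  is_derive y 1 (fun z => (z - a) `^ g) (g * (y - a) `^ (g - 1)).
Proof.
move=> ay; have ya0 : 0 < y - a by rewrite subr_gt0.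
apply: is_derive_eq.
  apply: (@is_derive1_comp _ (fun z => z `^ g) (fun z => z - a)) => //=.
  exact: is_derive1_powR.
by rewrite /= subr0 mulr1.
Qed.

Lemma integral_powR_away (R : realType) (a g c x : R) :
  g + 1 != 0 -> a < c -> c < x ->
  (\int[lebesgue_measure]_(y in `[c, x]) ((y - a) `^ g)%:E =
   ((x - a) `^ (g + 1) / (g + 1))%:E - ((c - a) `^ (g + 1) / (g + 1))%:E)%E.
Proof.
move=> g10 ac cx.
have dF y : a < y ->
    is_derive y 1 (fun z => (z - a) `^ (g + 1) / (g + 1)) ((y - a) `^ g).
  move=> ay; have := is_derive_shift_powR (g + 1) ay => dy.
  rewrite (_ : (fun _ => _) = (g + 1)^-1 *: (fun z => (z - a) `^ (g + 1))); last first.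
    by apply/funext => z; rewrite /= mulrC.
  apply: is_derive_eq => /=.
  by rewrite addrK /GRing.scale/= mulrA mulVf// mul1r.
have cF y : a < y -> (z - a) `^ (g + 1) / (g + 1) @[z --> y] -->
    (y - a) `^ (g + 1) / (g + 1).
  move=> ay; have /derivable1_diffP := @ex_derive _ _ _ _ _ _ _ (dF _ ay).
  exact: differentiable_continuous.
apply: (@continuous_FTC2 _ _ (fun z => (z - a) `^ (g + 1) / (g + 1))) => //.
- apply: derivable_within_continuous => y; rewrite in_itv/= => /andP[cy _].
  exact: (@ex_derive _ _ _ _ _ _ _ (is_derive_shift_powR g (lt_le_trans ac cy))).
- split.
  + move=> y; rewrite in_itv/= => /andP[cy _].
    exact: (@ex_derive _ _ _ _ _ _ _ (dF _ (lt_trans ac cy))).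
  + apply: cvg_at_right_filter; exact: cF.
  + apply: cvg_at_left_filter; apply: cF; exact: lt_trans cx.
- move=> y; rewrite in_itv/= => /andP[cy _].
  by rewrite derive1E; have [_ ->] := dF _ (lt_trans ac cy).
Qed.

(** When [g < 0] the integrand is unbounded at [a], so the integral is exhausted
    by intervals that stay away from [a]; the primitive tends to [0] there
    because [g + 1 > 0]. *)
Lemma integral_shift_powR (R : realType) (a g x : R) : -1 < g -> a < x ->
  (\int[lebesgue_measure]_(y in `]a, x]) ((y - a) `^ g)%:E =
   ((x - a) `^ (g + 1) / (g + 1))%:E)%E.
Proof.
move=> g1 ax; have g10 : 0 < g + 1 by rewrite -ltrBlDr sub0r.
have xa : 0 < x - a by rewrite subr_gt0.
pose c (n : nat) : R := a + (x - a) / n.+2%:R.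
have ac n : a < c n by rewrite ltrDl divr_gt0.
have cx n : c n < x.
  by rewrite /c -ltrBrDl ltr_pdivrMr// ltr_pMr// ltr1n.
have Uc : \bigcup_n `[c n, x]%classic = `]a, x]%classic.
  apply/seteqP; split => [y [n _]|y] /=; rewrite !in_itv/=.
    by move=> /andP[cy ->]; rewrite (lt_le_trans (ac n) cy).
  move=> /andP[ay yx].
  have ya : 0 < y - a by rewrite subr_gt0.
  exists (Num.truncn ((x - a) / (y - a))) => //=; rewrite in_itv/= yx andbT.
  rewrite /c -lerBrDl ler_pdivrMr// mulrC -ler_pdivrMr//.
  apply: ltW; apply: lt_le_trans (Num.Theory.truncnS_gt _) _.
  by rewrite ler_nat.
have mpow : measurable_fun [set: R] (fun y => ((y - a) `^ g)%:E).
  apply/measurable_EFinP.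
  apply: (measurableT_comp (measurable_powR g)).
  by apply: measurable_funB => //.
have ndc : {homo (fun n => `[c n, x]%classic) : n m / (n <= m)%N >-> (n <= m)%O}.
  move=> n m nm; apply/subsetPset; apply: subset_itvr; rewrite bnd_simp.
  by rewrite lerD2l ler_wpM2l ?(ltW xa)// lef_pV2 ?posrE// ler_nat.
have := @ge0_nondecreasing_set_cvg_integral _ (measurableTypeR R) R _
   (fun y : R => ((y - a) `^ g)%:E)
   lebesgue_measure ndc (fun _ => measurable_itv _)
   (fun _ => measurable_funTS mpow).
rewrite Uc => /(_ _)/cvg_lim <-//; last first.
  by move=> n y _; rewrite lee_fin powR_ge0.
have Gc0 : (c n - a) `^ (g + 1) / (g + 1) @[n --> \oo] --> 0.
  rewrite -(mul0r (g + 1)^-1); apply: cvgMr_tmp.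
  have /cvg_at_rightP := @powR_cvg0 R _ g10; apply; split.
    by move=> n; rewrite subr_gt0.
  rewrite /c.
  under eq_fun do rewrite addrAC subrr add0r.
  rewrite -(mulr0 (x - a)); apply: cvgMl_tmp.
  have := @cvg_harmonic R.
  by rewrite -(cvg_shiftS (@harmonic R)).
apply/cvg_lim => //.
under eq_fun do rewrite integral_powR_away ?(gt_eqF g10)//.
set v := ((x - a) `^ (g + 1) / (g + 1))%:E.
suff : (v - ((c n - a) `^ (g + 1) / (g + 1))%:E)%E @[n --> \oo] --> (v - 0)%E.
  by rewrite sube0.
apply: cvgeB => //; first exact: cvg_cst.
by apply: cvg_EFin; [exact: nearW|exact: Gc0].
Qed.

Lemma measurable_shift_powR (R : realType) (a g : R) (D : set R) :
  measurable_fun D (fun y => (y - a) `^ g).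
Proof.
apply: (@measurable_funTS _ _ R R).
apply: (measurableT_comp (measurable_powR g)).
exact: measurable_funB.
Qed.

Lemma integral_nu_shift_powR (R : realType) (a g k x : R) :
  0 <= k -> -1 < g -> a < x ->
  (\int[nu]_(y in `]a, x]) (k * (y - a) `^ g)%:E =
   (k * ((x - a) `^ (g + 1) / (g + 1)))%:E)%E.
Proof.
move=> k0 g1 ax.
have mg : measurable_fun `]a, x] (fun y => ((y - a) `^ g)%:E).
  by apply/measurable_EFinP; exact: measurable_shift_powR.
rewrite (integral_nu (D := `]a, x]%classic))//; last 2 first.
- exact: (measurable_funeM k%:E mg).
- by move=> y _; rewrite lee_fin mulr_ge0 ?powR_ge0.
under eq_integral do rewrite EFinM.
rewrite ge0_integralZl_EFin//; last by move=> y _; rewrite lee_fin powR_ge0.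
by rewrite integral_shift_powR.
Qed.

Lemma avg_shift_powR (R : realType) (a g x : R) : -1 < g -> a < x ->
  avg a (fun y => (y - a) `^ g) x = (x - a) `^ g / (g + 1).
Proof.
move=> g1 ax; rewrite /avg /Rintegral (integral_nu_obnd_cbnd (ltW ax)).
- under eq_integral do rewrite -[(_ - a) `^ g]mul1r.
  rewrite integral_nu_shift_powR//= mul1r mulrA; congr (_ / _).
  have xa : 0 < x - a by rewrite subr_gt0.
  rewrite powRD ?(gt_eqF xa) ?implybT// powRr1 ?(ltW xa)//.
  by rewrite mulrCA mulVf ?mulr1// gt_eqF.
- apply/measurable_EFinP/measurable_fun_lebT => //.
  exact: measurable_shift_powR.
- by move=> y _; rewrite lee_fin powR_ge0.
Qed.

Lemma integrable_shift_powR (R : realType) (a b g : R) : 0 <= g ->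
  nu.-integrable `[a, b] (EFin \o (fun y => (y - a) `^ g)).
Proof.
move=> g0; apply: (@measurable_bounded_integrable _ (lebT R) R nu) => //.
- exact: nu_itv_lty.
- apply: measurable_fun_lebT => //; exact: measurable_shift_powR.
- exists ((b - a) `^ g); split => // N bN y; rewrite /= in_itv/= => /andP[ay yb].
  apply: le_trans (ltW bN); rewrite ger0_norm ?powR_ge0//.
  by apply: ge0_ler_powR; rewrite ?nnegrE ?subr_ge0 ?lerD2r// (le_trans ay).
Qed.

(** Take [al + 1] strictly between [C^(1/q)] and [(p + 1) / p]; replacing [C] by
    its maximum with [1] keeps [al] positive. *)
Lemma exists_sharp_exponent (R : realType) (p q C : R) : 0 < p -> 0 < q ->
  C < ((p + 1) / p) `^ q ->
  exists al : R, [/\ 0 < al, al * p < 1 & C < (al + 1) `^ q].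
Proof.
move=> p0 q0 CK; set K := (p + 1) / p in CK.
have p1 : 0 < p^-1 by rewrite invr_gt0.
have EK : K = 1 + p^-1 by rewrite /K mulrDl mulfV ?gt_eqF// div1r.
have K1 : 1 < K by rewrite EK ltrDl.
have qi : 0 < q^-1 by rewrite invr_gt0.
pose m := Num.max C 1.
have m0 : 0 <= m by rewrite le_max ler01 orbT.
pose c := m `^ q^-1.
have cq : c `^ q = m by rewrite -powRrM mulVf ?gt_eqF// powRr1.
have c1 : 1 <= c.
  apply: (@le_trans _ _ (1 `^ q^-1)); first by rewrite powR1.
  by apply: ge0_ler_powR; rewrite ?nnegrE ?(ltW qi)// le_max lexx orbT.
have c0 : 0 <= c by rewrite (le_trans ler01).
have mK : m < K `^ q.
  rewrite gt_max CK/= (@le_lt_trans _ _ (1 `^ q))//; first by rewrite powR1.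
  by apply: gt0_ltr_powR; rewrite ?nnegrE// ltW// (lt_trans ltr01).
have cK : c < K.
  rewrite ltNge; apply/negP => Kc; move: mK; rewrite ltNge -cq.
  have K0 : 0 <= K by rewrite ltW// (lt_trans ltr01).
  by rewrite ge0_ler_powR ?nnegrE// ltW.
have [c2 K2] := midf_lt cK.
exists ((c + K) / 2 - 1); split.
- by rewrite subr_gt0 (le_lt_trans c1).
- by rewrite -ltr_pdivlMr// div1r ltrBlDl -EK.
- rewrite subrK (@le_lt_trans _ _ m)//; first by rewrite le_max lexx.
  rewrite -cq; apply: gt0_ltr_powR => //; rewrite nnegrE//.
  exact: le_trans (ltW c2).
Qed.

Lemma hardy_sharp (R : realType) (a b p q C : R) :
  a < b -> 0 < q -> q <= p -> C < ((p + 1) / p) `^ q ->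
  exists f : R -> R,
      [/\ (forall x, x \in `[a, b] -> 0 <= f x),
          nu.-integrable `[a, b] (EFin \o f),
          (\int[nu]_(x in `[a, b])
             (powe (avg a f x) (- p + q) * powe (f x) (- q)) < +oo)%E
        & (C%:E *
           \int[nu]_(x in `[a, b])
             (powe (avg a f x) (- p + q) * powe (f x) (- q))
           < \int[nu]_(x in `[a, b]) powe (avg a f x) (- p))%E].
Proof.
move=> ab q0 qp CK; have p0 : 0 < p by exact: lt_le_trans qp.
have [al [al0 alp Cal]] := exists_sharp_exponent p0 q0 CK.
have al1 : -1 < al by rewrite (lt_trans _ al0)// ltrN10.
have a10 : 0 < al + 1 by rewrite addr_gt0.
have b1 : -1 < - (al * p) by rewrite ltrN2.
pose f y := (y - a) `^ al.
have fpos x : a < x -> 0 < f x by move=> ax; rewrite powR_gt0// subr_gt0.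
have avgf x : a < x -> avg a f x = f x / (al + 1).
  by move=> ax; rewrite avg_shift_powR.
have avgpos x : a < x -> 0 < avg a f x by move=> ax; rewrite avgf// divr_gt0// fpos.
have fi := integrable_shift_powR a b (ltW al0).
have avgpow r x : a < x -> avg a f x `^ r = (al + 1) `^ (- r) * f x `^ r.
  move=> ax; rewrite avgf// powRM ?invr_ge0 ?(ltW a10) ?(ltW (fpos _ ax))//.
  by rewrite mulrC -powR_inv1 ?(ltW a10)// -powRrM mulN1r.
pose J : R := (b - a) `^ (- (al * p) + 1) / (- (al * p) + 1).
have J0 : 0 < J.
  by rewrite divr_gt0 ?powR_gt0 ?subr_gt0// addrC subr_gt0.
have fE x : f x `^ (- p) = (x - a) `^ (- (al * p)).
  by rewrite /f -powRrM mulrN.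
have mem x : x \in `]a, b]%classic -> a < x.
  by move=> /set_mem; rewrite /= in_itv/= => /andP[].
have IL : (\int[nu]_(x in `[a, b]) powe (avg a f x) (- p) =
    ((al + 1) `^ p * J)%:E)%E.
  rewrite (integral_nu_obnd_cbnd (ltW ab)); last 2 first.
    exact/measurable_powe_comp/measurable_avg/fi.
    by move=> x _; exact: powe_ge0.
  rewrite -integral_nu_shift_powR ?powR_ge0//.
  apply: eq_integral => x /mem ax.
  by rewrite powe_gt0E ?avgpos// avgpow// opprK fE.
have IQ : (\int[nu]_(x in `[a, b])
      (powe (avg a f x) (- p + q) * powe (f x) (- q)) =
    ((al + 1) `^ (p - q) * J)%:E)%E.
  rewrite (integral_nu_obnd_cbnd (ltW ab)); last 2 first.
    exact: measurable_integrand fi.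
    by move=> x _; rewrite mule_ge0 ?powe_ge0.
  rewrite -integral_nu_shift_powR ?powR_ge0//.
  apply: eq_integral => x /mem ax.
  rewrite !powe_gt0E ?avgpos ?fpos// avgpow// -EFinM opprD opprK -mulrA.
  by rewrite -powRD ?(gt_eqF (fpos _ ax)) ?implybT// addrK fE.
exists f; split => //.
- by move=> x _; exact: powR_ge0.
- by rewrite IQ ltry.
rewrite IQ IL -EFinM lte_fin mulrA ltr_pM2r//.
have -> : (al + 1) `^ p = (al + 1) `^ q * (al + 1) `^ (p - q).
  by rewrite -powRD ?(gt_eqF a10) ?implybT// subrKC.
by rewrite ltr_pM2r// powR_gt0.
Qed.

Theorem theorem1 (R : realType) (a b p q : R)
    (hab : a < b) (hq : 0 < q) (hqp : q <= p) :
  (forall f : R -> R,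
      (forall x, x \in `[a, b] -> 0 <= f x) ->
      (@completed_lebesgue_measure R).-integrable `[a, b] (EFin \o f) ->
      (\int[@completed_lebesgue_measure R]_(x in `[a, b])
          powe (avg a f x) (- p)
       <= (((p + 1) / p) `^ q)%:E *
          \int[@completed_lebesgue_measure R]_(x in `[a, b])
            (powe (avg a f x) (- p + q) * powe (f x) (- q)))%E)
  /\
  (forall C : R, C < ((p + 1) / p) `^ q ->
    exists f : R -> R,
      [/\ (forall x, x \in `[a, b] -> 0 <= f x),
          (@completed_lebesgue_measure R).-integrable `[a, b] (EFin \o f),
          (\int[@completed_lebesgue_measure R]_(x in `[a, b])
             (powe (avg a f x) (- p + q) * powe (f x) (- q)) < +oo)%E
        & (C%:E *
           \int[@completed_lebesgue_measure R]_(x in `[a, b])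
             (powe (avg a f x) (- p + q) * powe (f x) (- q))
           < \int[@completed_lebesgue_measure R]_(x in `[a, b])
               powe (avg a f x) (- p))%E]).
Proof.
split=> [f f0 fi|C CK]; first exact: hardy_inequality.
exact: hardy_sharp.
Qed.
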